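(* Let $\mathcal{H}$ be a separable infinite-dimensional complex Hilbert space, $T$ a bounded linear operator on $\mathcal{H}$, and $k\ge 1$ an integer. Then $T$ is a completely non-unitary contraction with $\mathcal{D}_T\subseteq\mathcal{D}_{T^*}$, $\dim\mathcal{D}_T=1$ and $\dim\mathcal{D}_{T^*}=k+1$ if and only if there exists an orthonormal basis $\{e_n\}_{n\geq 0}$ of $\mathcal{H}$ with respect to which $T=S_k+F$, where $S_ke_n=e_{n+k}$ ($n\ge0$) is the unilateral shift of multiplicity $k$ and $F$ is an operator of rank at most one given by $$F(e_0)=\alpha_0e_0+\alpha_1e_1+\cdots+\alpha_{k-1}e_{k-1}+(\alpha_k-1)e_k,\qquad F(e_n)=0\ \ (n\geq 1),$$ for some $\alpha_0,\dots,\alpha_k\in\mathbb{C}$ with $\sum_{i=0}^{k}|\alpha_i|^2<1$.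
   Context: For a contraction $T$ on $\mathcal{H}$, $\mathcal{D}_T=\overline{(I-T^*T)^{1/2}\mathcal{H}}$ and $\mathcal{D}_{T^*}=\overline{(I-TT^* )^{1/2}\mathcal{H}}$. A contraction is completely non-unitary if it has no nonzero reducing subspace on which it is unitary. *)

(* Defs.v *)
From HB Require Import structures.
From mathcomp Require Import all_boot all_order all_algebra.
From mathcomp Require Import complex.
From mathcomp Require Import all_classical all_reals all_analysis.
From Stdlib Require Import ClassicalEpsilon.
Set Implicit Arguments. Unset Strict Implicit. Unset Printing Implicit Defensive.
Import Order.TTheory GRing.Theory Num.Theory.
Import numFieldNormedType.Exports.
Local Open Scope classical_set_scope.
Local Open Scope ring_scope.

Section Hilbert.
Variable R : realType.
Local Notation C := R[i].
Variable H : completeNormedModType C.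
Variable ip : H -> H -> C.

(* ip is an inner product (linear in the first variable, conjugate symmetric)
   inducing the norm of H. Together with completeness of H: H is a complex Hilbert space. *)
Definition is_inner_product : Prop :=
  [/\ forall (a : C) (x y z : H), ip (a *: x + y) z = a * ip x z + ip y z,
      forall x y : H, ip x y = (ip y x)^* &
      forall x : H, ip x x = `|x| ^+ 2].

Definition lin_indep (n : nat) (v : 'I_n -> H) : Prop :=
  forall c : 'I_n -> C, \sum_(i < n) c i *: v i = 0 -> forall i, c i = 0.

Definition span_fin (n : nat) (v : 'I_n -> H) : set H :=
  [set x | exists c : 'I_n -> C, x = \sum_(i < n) c i *: v i].

Definition infinite_dimensional : Prop :=
  forall n : nat, exists v : 'I_n -> H, lin_indep v.

Definition separable_space : Prop :=
  exists D : set H, countable D /\ closure D = setT.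

Definition has_dim (M : set H) (n : nat) : Prop :=
  exists v : 'I_n -> H, lin_indep v /\ M = span_fin v.

Definition bounded_linear (T : H -> H) : Prop :=
  linear T /\ exists M : C, 0 <= M /\ forall x, `|T x| <= M * `|x|.

Definition contraction_op (T : H -> H) : Prop := forall x, `|T x| <= `|x|.

Definition is_adjoint (T Ts : H -> H) : Prop :=
  forall x y, ip (T x) y = ip x (Ts y).

Definition op_adjoint (T : H -> H) : H -> H :=
  epsilon (inhabits (fun x : H => x)) (fun Ts => bounded_linear Ts /\ is_adjoint T Ts).

Definition positive_op (A : H -> H) : Prop :=
  bounded_linear A /\ forall x, 0 <= ip (A x) x.

Definition op_sqrt (A : H -> H) : H -> H :=
  epsilon (inhabits (fun x : H => x)) (fun B => positive_op B /\ B \o B = A).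

Definition defect_space (T : H -> H) : set H :=
  closure (range (op_sqrt (fun x => x - op_adjoint T (T x)))).

Definition closed_subspace (M : set H) : Prop :=
  [/\ M 0, (forall x y, M x -> M y -> M (x + y)),
      (forall (a : C) x, M x -> M (a *: x)) & closed M].

Definition reducing (T : H -> H) (M : set H) : Prop :=
  [/\ closed_subspace M, T @` M `<=` M & op_adjoint T @` M `<=` M].

(* the restriction of T to M (assumed invariant) is a unitary operator on M *)
Definition unitary_on (T : H -> H) (M : set H) : Prop :=
  (forall x, M x -> `|T x| = `|x|) /\ M `<=` T @` M.

Definition completely_non_unitary (T : H -> H) : Prop :=
  forall M : set H, reducing T M -> unitary_on T M -> M = [set 0].

Definition span_seq (e : nat -> H) : set H :=
  [set x | exists (n : nat) (c : 'I_n -> C), x = \sum_(i < n) c i *: e i].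

Definition orthonormal_basis (e : nat -> H) : Prop :=
  (forall m n, ip (e m) (e n) = (m == n)%:R) /\ closure (span_seq e) = setT.

End Hilbert.

(* Main.v *)
(* For a contraction T, the orthogonal complement of D_T is the fixed space of
   T^*T, and T maps it isometrically onto the orthogonal complement of D_(T^* ).

   If D_T is a line inside the (k+1)-dimensional D_(T^* ), take a unit vector e_0
   of D_T, complete it to an orthonormal basis e_0, ..., e_k of D_(T^* ), and put
   e_(n+k) = T e_n for n >= 1.  These vectors are orthonormal; the orthogonal
   complement of their span is reducing and T is unitary on it, so it is zero.
   The alpha_i are the coordinates of T e_0, which lies in D_(T^* ).

   Conversely, in such a basis I - T^*T = (1 - |T e_0|^2) <., e_0> e_0 and the fixed
   space of TT^* is the orthogonal complement of e_0, ..., e_k.  On a reducing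
   subspace where T is unitary, vectors are orthogonal to e_0, ..., e_k, and
   <x, e_(n+k)> = <T^* x, e_n> propagates this to all e_n. *)
Require Import Defs.
From HB Require Import structures.
From mathcomp Require Import all_boot all_order all_algebra.
From mathcomp Require Import complex.
From mathcomp Require Import all_classical all_reals all_analysis.
From mathcomp Require Import ring lra.
Import Order.TTheory GRing.Theory Num.Theory.
Import numFieldNormedType.Exports.
Local Open Scope classical_set_scope.
Local Open Scope ring_scope.
Set Implicit Arguments.
Unset Strict Implicit.
Unset Printing Implicit Defensive.

(** * Archimedean property and infima in the partially ordered field [R[i]] *)

Section ComplexOrder.
Variable R : realType.
Local Notation C := R[i].

(** In the order of [R[i]], [0 < eps] forces [eps] to be real, so the archimedean property of [R]
    applies. *)
Lemma archi_invC (eps : C) : 0 < eps -> exists N : nat, N.+1%:R^-1 < eps.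
Proof.
move=> e0; have /RRe_real eR := gtr0_real e0.
move: e0; rewrite -eR -[0]/(0%:C%C) ltcR => e0.
exists (Num.bound (complex.Re eps)^-1).
rewrite -[_.+1%:R](rmorph_nat (real_complex R)) -fmorphV ltcR.
rewrite invf_plt ?posrE// (lt_le_trans (archi_boundP _)) ?invr_ge0 ?ltW//.
by rewrite ltr_nat.
Qed.

Lemma has_infC (E : set C) : E !=set0 -> (forall x, E x -> 0 <= x) ->
  exists2 d : C, (forall x, E x -> d <= x) &
    (forall eps, 0 < eps -> exists2 x, E x & x < d + eps).
Proof.
move=> [w Ew] E0; pose F : set R := [set complex.Re x | x in E].
have ReE x : E x -> (complex.Re x)%:C%C = x by move=> /E0 /ger0_real /RRe_real.
have F0 : has_lbound F.
  by exists 0 => _ [x Ex <-]; rewrite -ler0c ReE//; exact: E0.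
have hF : has_inf F by split=> //; exists (complex.Re w), w.
exists (inf F)%:C%C => [x Ex|eps e0].
  by rewrite -(ReE x Ex) lecR; apply: ge_inf => //; exists x.
have /RRe_real eR := gtr0_real e0.
move: e0; rewrite -eR -[0]/(0%:C%C) ltcR => e0.
have [_ [x Ex <-] xlt] := inf_adherent e0 hF; exists x => //.
by rewrite -(ReE x Ex) -rmorphD ltcR.
Qed.

End ComplexOrder.

(** Descent for strong inductions on basis indices: past [k], the vector e_n is T e_m with
    [0 < m < n]. *)
Lemma ltn_split (k n : nat) : (0 < k)%N -> (k < n)%N ->
  exists2 m, (0 < m < n)%N & n = (m + k)%N.
Proof.
move=> k0 kn; exists (n - k)%N; last by rewrite subnK// ltnW.
by rewrite subn_gt0 kn ltn_subrL k0 (leq_ltn_trans _ kn).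
Qed.

(** * Elementary consequences of linearity *)

Section LinearMaps.
Variables (K : pzRingType) (U V : lmodType K) (f : U -> V).
Hypothesis linf : linear f.

Lemma lin0 : f 0 = 0.
Proof. by have := linf (-1) 0 0; rewrite scaler0 add0r scaleN1r addNr. Qed.

Lemma linD x y : f (x + y) = f x + f y.
Proof. by have := linf 1 x y; rewrite !scale1r. Qed.

Lemma linZ a x : f (a *: x) = a *: f x.
Proof. by have := linf a x 0; rewrite lin0 !addr0. Qed.

Lemma linN x : f (- x) = - f x.
Proof. by rewrite -scaleN1r linZ scaleN1r. Qed.

Lemma linB x y : f (x - y) = f x - f y.
Proof. by rewrite linD linN. Qed.

Lemma lin_sum n (F : 'I_n -> U) : f (\sum_(i < n) F i) = \sum_(i < n) f (F i).
Proof. exact: (big_morph f linD lin0). Qed.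

End LinearMaps.

(** * Inner product identities and the Cauchy-Schwarz inequality *)

Section HilbertSpace.
Variables (R : realType) (H : completeNormedModType R[i]) (ip : H -> H -> R[i]).
Hypothesis hip : is_inner_product ip.
Implicit Types (x y z : H) (a : R[i]) (T A B : H -> H).

Lemma ipC x y : ip x y = (ip y x)^*.
Proof. by case: hip. Qed.

Lemma ip_norm x : ip x x = `|x| ^+ 2.
Proof. by case: hip. Qed.

Lemma ip_linl z : linear (fun x => ip x z : R[i]^o).
Proof. by case: hip => + _ _ a x y; exact. Qed.

Lemma ip0l z : ip 0 z = 0. Proof. exact: lin0 (ip_linl z). Qed.
Lemma ipDl x y z : ip (x + y) z = ip x z + ip y z.
Proof. exact: linD (ip_linl z) x y. Qed.
Lemma ipZl a x z : ip (a *: x) z = a * ip x z.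
Proof. exact: linZ (ip_linl z) a x. Qed.
Lemma ipNl x z : ip (- x) z = - ip x z.
Proof. exact: linN (ip_linl z) x. Qed.
Lemma ipBl x y z : ip (x - y) z = ip x z - ip y z.
Proof. exact: linB (ip_linl z) x y. Qed.
Lemma ip_suml n (F : 'I_n -> H) z : ip (\sum_(i < n) F i) z = \sum_(i < n) ip (F i) z.
Proof. exact: lin_sum (ip_linl z) n F. Qed.

Lemma ip0r z : ip z 0 = 0. Proof. by rewrite ipC ip0l rmorph0. Qed.
Lemma ipDr x y z : ip z (x + y) = ip z x + ip z y.
Proof. by rewrite ipC ipDl rmorphD /= -!ipC. Qed.
Lemma ipZr a x z : ip z (a *: x) = a^* * ip z x.
Proof. by rewrite ipC ipZl rmorphM /= -ipC. Qed.
Lemma ipNr x z : ip z (- x) = - ip z x.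
Proof. by rewrite ipC ipNl rmorphN /= -ipC. Qed.
Lemma ipBr x y z : ip z (x - y) = ip z x - ip z y.
Proof. by rewrite ipDr ipNr. Qed.
Lemma ip_sumr n (F : 'I_n -> H) z : ip z (\sum_(i < n) F i) = \sum_(i < n) ip z (F i).
Proof. by rewrite ipC ip_suml rmorph_sum; apply: eq_bigr => i _; rewrite /= -ipC. Qed.

Lemma ip_eq0C x y : ip x y = 0 -> ip y x = 0.
Proof. by move=> h; rewrite ipC h rmorph0. Qed.

Lemma ip_eq0 x : ip x x = 0 -> x = 0.
Proof. by rewrite ip_norm => /eqP; rewrite expf_eq0 normr_eq0 => /eqP. Qed.

Lemma ip_ext x y : (forall z, ip x z = ip y z) -> x = y.
Proof. by move=> h; apply/subr0_eq/ip_eq0; rewrite ipBl h subrr. Qed.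

Lemma norm2D x y : `|x + y| ^+ 2 = `|x| ^+ 2 + `|y| ^+ 2 + (ip x y + ip y x).
Proof. by rewrite -!ip_norm ipDl !ipDr; ring. Qed.

Lemma parallelogram x y : `|x + y| ^+ 2 + `|x - y| ^+ 2 = (`|x| ^+ 2 + `|y| ^+ 2) *+ 2.
Proof.
rewrite !norm2D normrN ipNl ipNr -opprD addrACA subrr addr0.
by rewrite mulr2n.
Qed.

(** Pythagoras for the projection of [x] onto the line of [y]; it yields both Cauchy-Schwarz and the
    orthogonality of minimizers. *)
Lemma norm_residual x y : y != 0 ->
  `|x - (ip x y / `|y| ^+ 2) *: y| ^+ 2 = `|x| ^+ 2 - `|ip x y| ^+ 2 / `|y| ^+ 2.
Proof.
move=> y0; have n0 : 0 < `|y| by rewrite normr_gt0.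
rewrite -(ip_norm (x - _)) ipBl !ipBr !ipZl !ipZr !ip_norm (ipC y x).
have -> : (ip x y / `|y| ^+ 2)^* = (ip x y)^* / `|y| ^+ 2.
  by rewrite rmorphM fmorphV /=; congr (_ / _); rewrite -ip_norm -ipC.
rewrite [_ / _ * (_ / _ * _)]mulrCA divfK ?expf_neq0 ?gt_eqF//.
rewrite [_ / _ * _ ^*]mulrAC [_ ^* / _ * _]mulrAC [_ ^* * _]mulrC subrr subr0.
by rewrite -normCK.
Qed.

Lemma cauchy_schwarz x y : `|ip x y| <= `|x| * `|y|.
Proof.
have [->|y0] := eqVneq y 0; first by rewrite ip0r normr0 mulr_ge0.
rewrite -(@ler_pXn2r _ 2%N) ?nnegrE ?mulr_ge0// exprMn.
have := exprn_ge0 2 (normr_ge0 (x - (ip x y / `|y| ^+ 2) *: y)).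
by rewrite norm_residual// subr_ge0 ler_pdivrMr ?exprn_gt0 ?normr_gt0.
Qed.

Lemma norm_le0_eps (V : normedZmodType R[i]) (v : V) :
  (forall eps : R[i], 0 < eps -> `|v| <= eps) -> v = 0.
Proof.
move=> h; apply/eqP; rewrite -normr_eq0 -[_ == _]negbK; apply/negP => v0.
have v1 : 0 < `|v| by rewrite lt0r v0 normr_ge0.
have v2 : 0 < `|v| / 2 by rewrite divr_gt0.
by have := lt_le_trans (midf_lt v1).2 (h _ v2) ; rewrite add0r ltxx.
Qed.

(** * Orthogonal projection, Riesz representation and adjoints *)

Lemma cauchy_seq_cvg (u : nat -> H) :
  (forall eps : R[i], 0 < eps -> exists N, forall n, (N <= n)%N -> `|u N - u n| < eps) ->
  exists l : H, u @ \oo --> l.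
Proof.
move=> h; have /cauchy_cvgP/cvg_ex[l ul] : cauchy (u @ \oo).
  apply: cauchy_exP => eps /h[N hN]; exists (u N).
  exists N => // n /= Nn; rewrite -ball_normE; exact: hN.
by exists l.
Qed.

Lemma cvg_seqP (u : nat -> H) (l : H) : u @ \oo --> l <->
  (forall eps : R[i], 0 < eps -> exists N, forall n, (N <= n)%N -> `|l - u n| < eps).
Proof.
split=> [/cvgrPdist_lt h eps /h[N _ hN]|h]; first by exists N.
by apply/cvgrPdist_lt => eps /h[N hN]; exists N.
Qed.

Lemma closure_norm (M : set H) x : closure M x <->
  (forall eps : R[i], 0 < eps -> exists2 y, M y & `|x - y| < eps).
Proof.
split=> [h eps e0|h V /nbhs_ballP[e /= e0 eV]].
  have [y [My]] := h _ (nbhsx_ballx x eps e0).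
  by rewrite -ball_normE; exists y.
by have [y My xy] := h e e0; exists y; split=> //; apply: eV; rewrite -ball_normE.
Qed.

Lemma closed_orthogonal (S : set H) : closed [set x | forall y, S y -> ip x y = 0].
Proof.
move=> x /closure_norm h y Sy; apply: norm_le0_eps => eps e0.
(* Adding 1 keeps the denominator positive when [y = 0]. *)
have y0 : 0 < `|y| + 1 by rewrite ltr_wpDl.
have [z /(_ y Sy) zy /ltW xz] := h (eps / (`|y| + 1)) (divr_gt0 e0 y0).
rewrite -[ip x y]subr0 -zy -ipBl (le_trans (cauchy_schwarz _ _))//.
rewrite (le_trans (ler_wpM2r _ xz))// -mulrA ger_pMr// mulrC ler_pdivrMr// mul1r.
by rewrite lerDl.
Qed.

Lemma cvg_norm_le (u : nat -> H) (l : H) (c : R[i]) (N : nat) :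
  u @ \oo --> l -> (forall n, (N <= n)%N -> `|u n| <= c) -> `|l| <= c.
Proof.
move=> /cvg_seqP ul uc; apply/ler_addgt0Pr => eps /ul[M /(_ (maxn M N)) lM].
rewrite -(subrK (u (maxn M N)) l) addrC (le_trans (ler_normD _ _))//.
by rewrite lerD ?uc ?leq_maxr// ltW// lM// leq_maxl.
Qed.

(** The difference of the two sides is <l - u_n, y> + <x, v_n - m>, small by Cauchy-Schwarz. This
    carries self-adjointness to pointwise limits. *)
Lemma ip_cvg_eq (u v : nat -> H) (l m x y : H) : u @ \oo --> l -> v @ \oo --> m ->
  (forall n, ip (u n) y = ip x (v n)) -> ip l y = ip x m.
Proof.
move=> /cvg_seqP ul /cvg_seqP vm h; apply/subr0_eq/norm_le0_eps => eps e0.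
have s0 : 0 < `|y| + `|x| + 1 by rewrite ltr_wpDl// addr_ge0.
have d0 : 0 < eps / (`|y| + `|x| + 1) by rewrite divr_gt0.
have [N hN] := ul _ d0; have [M hM] := vm _ d0.
have /ltW un := hN _ (leq_maxl N M); have /ltW vn := hM _ (leq_maxr N M).
rewrite -(subrKA (ip x (v (maxn N M)))) -{1}h -ipBl -ipBr.
rewrite (le_trans (ler_normD _ _))//.
rewrite (le_trans (lerD (cauchy_schwarz _ _) (cauchy_schwarz _ _)))//.
have -> : eps = eps / (`|y| + `|x| + 1) * (`|y| + `|x| + 1) by rewrite divfK ?gt_eqF.
rewrite 2!mulrDr -addrA lerD ?ler_wpM2r// mulr1 ler_wpDr ?(ltW d0)//.
by rewrite [`|x| * _]mulrC ler_wpM2r// distrC.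
Qed.

(** The parallelogram law makes a minimizing sequence Cauchy, since midpoints stay in [K] and cannot
    have norm below the infimum. *)
Lemma min_norm_element (K : set H) : K !=set0 -> closed K ->
  (forall x y, K x -> K y -> K (2^-1 *: (x + y))) ->
  exists2 z, K z & forall y, K y -> `|z| ^+ 2 <= `|y| ^+ 2.
Proof.
move=> [w Kw] Kcl Kmid.
have [||d dle dlt] := @has_infC R [set `|x| ^+ 2 | x in K].
- by exists (`|w| ^+ 2), w.
- by move=> _ [x _ <-]; rewrite exprn_ge0.
have dle2 x y : K x -> K y -> d *+ 4 <= `|x + y| ^+ 2.
  move=> Kx Ky; have := dle _ (ex_intro2 _ _ _ (Kmid _ _ Kx Ky) erefl).
  rewrite normrZ exprMn normfV normr_nat exprVn mulrC ler_pdivlMr ?exprn_gt0//.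
  by rewrite -natrX mulr_natr.
have /choice[u uP] (n : nat) : exists x, K x /\ `|x| ^+ 2 < d + n.+1%:R^-1.
  have [|_ [x Kx <-] xlt] := dlt (n.+1%:R^-1); first by rewrite invr_gt0.
  by exists x.
have uK n : K (u n) by case: (uP n).
have [|z uz] := @cauchy_seq_cvg u.
  (* With both squared norms below d + eps^2/4, the parallelogram law bounds |u_N - u_n|^2 by 4(d +
     eps^2/4) - 4d = eps^2. *)
  move=> eps e0; have e2 : 0 < eps ^+ 2 / 4 by rewrite divr_gt0// exprn_gt0.
  have [N hN] := archi_invC e2; exists N => n Nn.
  rewrite -(@ltr_pXn2r _ 2%N) ?nnegrE ?(ltW e0)//.
  have := parallelogram (u N) (u n); rewrite addrC => /(canRL (addrK _)) ->.
  have hn : `|u n| ^+ 2 < d + eps ^+ 2 / 4.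
    apply: lt_trans (proj2 (uP n)) _; rewrite ltrD2l; apply: le_lt_trans hN.
    by rewrite lef_pV2 ?posrE// ler_nat.
  have hu : `|u N| ^+ 2 < d + eps ^+ 2 / 4.
    by apply: lt_trans (proj2 (uP N)) _; rewrite ltrD2l.
  rewrite ltrBlDr; apply: (@lt_le_trans _ _ ((d + eps ^+ 2 / 4) *+ 4)).
    by rewrite -[4%N]/(2 * 2)%N mulrnA ltrMn2r/= mulr2n ltrD.
  rewrite mulrnDl -(mulr_natr (_ / _)) divfK ?pnatr_eq0// addrC lerD2l.
  exact: dle2.
exists z; first by apply: (closed_cvg K Kcl _ z uz); apply: nearW.
move=> y Ky; apply: (@le_trans _ _ d); last by apply: dle; exists y.
apply/ler_addgt0Pr => eps e0; have [N hN] := archi_invC e0.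
have de0 : 0 <= d + eps.
  apply: le_trans (ltW (lt_trans (proj2 (uP N)) _)); first exact: exprn_ge0.
  by rewrite ltrD2l.
rewrite -[d + eps]sqrtCK ler_pXn2r ?nnegrE ?sqrtC_ge0//.
apply: (cvg_norm_le (N := N) uz) => n Nn.
rewrite -(@ler_pXn2r _ 2%N) ?nnegrE ?sqrtC_ge0// sqrtCK ltW//.
apply: lt_trans (proj2 (uP n)) _; rewrite ltrD2l (le_lt_trans _ hN)//.
by rewrite lef_pV2 ?posrE// ler_nat.
Qed.

(** Subtracting the projection onto [y] lowers |x|^2 by |<x,y>|^2/|y|^2, which minimality forces to
    vanish. *)
Lemma minimal_orthogonal x y :
  (forall a, `|x| ^+ 2 <= `|x - a *: y| ^+ 2) -> ip x y = 0.
Proof.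
move=> h; have [->|y0] := eqVneq y 0; first by rewrite ip0r.
have := h (ip x y / `|y| ^+ 2); rewrite norm_residual// lerDl oppr_ge0.
rewrite pmulr_lle0 ?invr_gt0 ?exprn_gt0 ?normr_gt0// => xy0.
by apply/eqP; rewrite -normr_eq0 -sqrf_eq0 eq_le xy0 exprn_ge0.
Qed.

Lemma projection (M : set H) x : closed_subspace M ->
  exists2 p, M p & forall y, M y -> ip (x - p) y = 0.
Proof.
move=> [M0 MD MZ Mcl].
(* The set is the coset x + M; its shortest vector [z] is the component of [x] orthogonal to [M],
   and p = x - z. *)
have [|||z Mz zmin] := @min_norm_element [set z | M (x - z)].
- by exists x; rewrite /= subrr.
- move=> z /closure_norm cz; apply/Mcl/closure_norm => eps /cz[y My zy].
  by exists (x - y) => //; rewrite opprB addrC addrA subrK distrC.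
- move=> y z /= My Mz.
  have -> : x - 2^-1 *: (y + z) = 2^-1 *: ((x - y) + (x - z)).
    by rewrite addrACA -opprD -mulr2n scalerBr -(scaler_nat 2 x) scalerA mulVf ?scale1r.
  exact/MZ/MD.
exists (x - z) => // y My; rewrite opprB addrC subrK.
apply: minimal_orthogonal => a; apply: zmin => /=.
by rewrite opprB addrCA addrC; apply: MD => //; apply: MZ.
Qed.

(** If [f] is nonzero, take [q] nonzero and orthogonal to the closed kernel. As x - (f x / f q) q
    lies in the kernel, pairing it with [q] recovers [f x]. *)
Lemma riesz (f : H -> R[i]^o) (M : R[i]) : linear f ->
  (forall x, `|f x| <= M * `|x|) -> exists z, forall x, f x = ip x z.
Proof.
move=> linf fM.
have [f0|/existsNP[w /eqP fw0]] := pselect (forall x, f x = 0).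
  by exists 0 => x; rewrite ip0r.
have kerf : closed_subspace [set x | f x = 0].
  split=> /=; [exact: lin0| | |].
  - by move=> x y fx fy; rewrite linD// fx fy addr0.
  - by move=> a x fx; rewrite linZ// fx scaler0.
  move=> x /closure_norm h; apply: norm_le0_eps => eps e0.
  have M0 : 0 <= M by have := le_trans (normr_ge0 _) (fM w); rewrite pmulr_lge0 ?normr_gt0//;
    apply: contraNneq fw0 => ->; rewrite lin0.
  have M1 : 0 < M + 1 by rewrite ltr_wpDl.
  have [y fy /ltW xy] := h (eps / (M + 1)) (divr_gt0 e0 M1).
  rewrite -[f x]subr0 -fy -linB// (le_trans (fM _))// (le_trans (ler_wpM2l M0 xy))//.
  by rewrite mulrCA ger_pMr// ler_pdivrMr// mul1r lerDl.
have [p fp qN] := projection w kerf; set q := w - p in qN.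
have fq : f q = f w by rewrite linB// fp subr0.
have q0 : q != 0 by apply: contraNneq fw0 => q0; rewrite -fq q0 lin0.
exists (((f q)^* / `|q| ^+ 2) *: q) => x.
have /ip_eq0C : ip q (x - (f x / f q) *: q) = 0.
  apply: qN => /=; rewrite linB// linZ// -[_ *: f q]/((f x / f q) * f q).
  by rewrite divfK ?subrr// fq.
rewrite ipBl ipZl ip_norm => /subr0_eq xq.
rewrite ipZr xq rmorphM fmorphV/= conjCK -(ip_norm q) -ipC ip_norm.
rewrite mulrACA mulVf ?expf_neq0 ?normr_eq0// mulr1 mulrC divfK// fq//.
Qed.

Lemma adjoint_exists T : bounded_linear T ->
  exists Ts, bounded_linear Ts /\ is_adjoint ip T Ts.
Proof.
move=> [linT [M [M0 TM]]].
have /choice[Ts adjT] y : exists z, forall x, ip (T x) y = ip x z.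
  apply: (@riesz (fun x => ip (T x) y) (M * `|y|)).
    by move=> a u v; rewrite linT ipDl ipZl.
  move=> x; rewrite (le_trans (cauchy_schwarz _ _))// mulrAC.
  by rewrite ler_wpM2r.
exists Ts; split; last by move=> x y; exact: adjT.
split.
  move=> a x y; apply: ip_ext => z; apply/(can_inj conjCK); rewrite -!ipC.
  by rewrite -adjT !ipDr !ipZr -!adjT.
exists M; split=> // y.
have [->|y0] := eqVneq (Ts y) 0; first by rewrite normr0 mulr_ge0.
(* Here |Ts y|^2 = <T (Ts y), y> <= M |Ts y| |y|, and one factor |Ts y| cancels. *)
rewrite -(@ler_pM2r _ `|Ts y|) ?normr_gt0// -expr2 -ip_norm -adjT.
apply: le_trans (real_ler_norm _) _.
  by rewrite adjT ip_norm realX// normr_real.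
rewrite (le_trans (cauchy_schwarz _ _))// mulrAC.
by rewrite ler_wpM2r.
Qed.

Lemma op_adjointP T : bounded_linear T ->
  bounded_linear (op_adjoint ip T) /\ is_adjoint ip T (op_adjoint ip T).
Proof. by move=> /adjoint_exists; exact: ClassicalEpsilon.epsilon_spec. Qed.

Lemma is_adjoint_sym T A : is_adjoint ip T A -> is_adjoint ip A T.
Proof. by move=> h x y; rewrite ipC -h -ipC. Qed.

Lemma op_adjointK T : bounded_linear T -> op_adjoint ip (op_adjoint ip T) = T.
Proof.
move=> bT; have [bTs adj] := op_adjointP bT; have [_ adj2] := op_adjointP bTs.
apply/funext => y; apply: ip_ext => z; apply/(can_inj conjCK); rewrite -!ipC.
by rewrite -adj2 (is_adjoint_sym adj).
Qed.

Lemma contraction_adjoint T A :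
  contraction_op T -> is_adjoint ip T A -> contraction_op A.
Proof.
move=> cT adj y.
have [->|y0] := eqVneq (A y) 0; first by rewrite normr0.
rewrite -(@ler_pM2r _ `|A y|) ?normr_gt0// -expr2 -ip_norm -adj.
apply: le_trans (real_ler_norm _) _.
  by rewrite adj ip_norm realX// normr_real.
by rewrite (le_trans (cauchy_schwarz _ _))// mulrC ler_wpM2l.
Qed.

(** * Positive square roots *)

Section SquareRoot.
Variable C : H -> H.
Hypotheses (linC : linear C) (conC : contraction_op C) (selfC : is_adjoint ip C C).

(* The iteration Y <- (C + Y^2) / 2 converges to I - (I - C)^(1/2); its
   increments are dominated by those of the same iteration on scalars at C = 1. *)
Fixpoint sqrt_iter n x :=
  if n is m.+1 then 2^-1 *: (C x + sqrt_iter m (sqrt_iter m x)) else 0.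

Fixpoint sqrt_bound n : R :=
  if n is m.+1 then 2^-1 * (1 + sqrt_bound m ^+ 2) else 0.

Local Notation Y := sqrt_iter.
Local Notation b := sqrt_bound.

Lemma sqrt_bound_itv n : 0 <= b n <= 1.
Proof. by elim: n => [|n /andP[h0 h1]] /=; [lra|apply/andP; split; nra]. Qed.

(** The increment equals (b_n - 1)^2 / 2. *)
Lemma sqrt_bound_incr n : b n <= b n.+1.
Proof. by have /= := sqr_ge0 (b n - 1); nra. Qed.

Lemma sqrt_iter_linear n : linear (Y n).
Proof.
elim: n => [|n ih] a x y /=; first by rewrite scaler0 addr0.
rewrite linC !ih scalerA mulrC -scalerA -scalerDr; congr (_ *: _).
by rewrite scalerDr addrACA.
Qed.

Lemma sqrt_iter_self n : is_adjoint ip (Y n) (Y n).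
Proof.
elim: n => [|n ih] x y /=; first by rewrite ip0l ip0r.
by rewrite ipZl ipZr ipDl ipDr selfC !ih fmorphV rmorph_nat.
Qed.

Lemma norm_sqrt_iter n x : `|Y n x| <= (b n)%:C%C * `|x|.
Proof.
elim: n x => [|n ih] x /=; first by rewrite normr0 mul0r.
rewrite normrZ normfV normr_nat rmorphM fmorphV rmorph_nat -mulrA.
rewrite ler_wpM2l ?invr_ge0//= rmorphD rmorph1 rmorphXn mulrDl mul1r.
rewrite (le_trans (ler_normD _ _))// lerD ?conC//.
rewrite (le_trans (ih _))// expr2 -mulrA ler_wpM2l// ler0c.
by case/andP: (sqrt_bound_itv n).
Qed.

Lemma norm_sqrt_iter_incr n x : `|Y n.+1 x - Y n x| <= (b n.+1 - b n)%:C%C * `|x|.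
Proof.
elim: n x => [|n ih] x.
  rewrite /= !subr0 addr0 normrZ normfV normr_nat rmorphM fmorphV rmorph_nat.
  by rewrite expr0n addr0 rmorph1 mulr1 ler_wpM2l ?invr_ge0.
(* The difference of squares Y_(n+1)^2 - Y_n^2 is split without commuting factors, as
   Y_(n+1)(Y_(n+1) - Y_n) + (Y_(n+1) - Y_n)Y_n; the scalars split the same way. *)
have -> : Y n.+2 x - Y n.+1 x =
    2^-1 *: (Y n.+1 (Y n.+1 x - Y n x) + (Y n.+1 (Y n x) - Y n (Y n x))).
  rewrite (linB (sqrt_iter_linear n.+1)) subrKA.
  transitivity (2^-1 *: (C x + Y n.+1 (Y n.+1 x)) - 2^-1 *: (C x + Y n (Y n x))) => //.
  by rewrite -scalerBr opprD addrACA subrr add0r.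
have -> : b n.+2 - b n.+1 = 2^-1 * (b n.+1 * (b n.+1 - b n) + (b n.+1 - b n) * b n).
  transitivity (2^-1 * (1 + b n.+1 ^+ 2) - 2^-1 * (1 + b n ^+ 2)) => //.
  by move: (b n.+1) (b n) => s t; ring.
have d0 : 0 <= (b n.+1 - b n)%:C%C by rewrite ler0c subr_ge0 sqrt_bound_incr.
have b0 : 0 <= (b n.+1)%:C%C by rewrite ler0c; case/andP: (sqrt_bound_itv n.+1).
rewrite normrZ normfV normr_nat rmorphM fmorphV rmorph_nat -mulrA.
rewrite ler_wpM2l ?invr_ge0// rmorphD.
rewrite (rmorphM _ (b n.+1)) (rmorphM _ (b n.+1 - b n)) mulrDl -!mulrA.
rewrite (le_trans (ler_normD _ _))// lerD//.
  exact: le_trans (norm_sqrt_iter n.+1 _) (ler_wpM2l b0 (ih x)).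
exact: le_trans (ih _) (ler_wpM2l d0 (norm_sqrt_iter n x)).
Qed.

Lemma norm_sqrt_iterB m n x : (m <= n)%N ->
  `|Y m x - Y n x| <= (b n - b m)%:C%C * `|x|.
Proof.
move=> /subnKC <-; elim: (n - m)%N => [|k ih]; first by rewrite addn0 !subrr normr0 mul0r.
rewrite addnS distrC -(subrKA (Y (m + k) x)) -(subrKA (b (m + k))) rmorphD mulrDl.
by rewrite (le_trans (ler_normD _ _))// lerD ?norm_sqrt_iter_incr// distrC.
Qed.

(** The scalars b_n increase and are bounded by 1, so from some N on b_n - b_N is as small as
    desired, and it dominates the increments of Y_n x. *)
Lemma sqrt_iter_cvg x : exists l : H, Y n x @[n --> \oo] --> l.
Proof.
have hs : has_sup (range b).
  split; first by exists (b 0%N), 0%N.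
  by exists 1 => _ [n _ <-]; case/andP: (sqrt_bound_itv n).
apply: cauchy_seq_cvg => eps e0.
have x1 : 0 < `|x| + 1 by rewrite ltr_wpDl.
have d0 : 0 < eps / (`|x| + 1) by rewrite divr_gt0.
have dR := RRe_real (gtr0_real d0).
have r0 : 0 < complex.Re (eps / (`|x| + 1)) by rewrite -ltcR dR.
have [_ [N _ <-] sN] := sup_adherent r0 hs; exists N => n Nn.
apply: le_lt_trans (norm_sqrt_iterB x Nn) _.
apply: (@le_lt_trans _ _ (eps / (`|x| + 1) * `|x|)).
  rewrite ler_wpM2r// -dR lecR lerBlDl -lerBlDr (le_trans _ (ltW sN))//.
  by rewrite lerB//; apply: ub_le_sup; [case: hs|exists n].
by rewrite mulrAC ltr_pdivrMr// ltr_pM2l// ltrDl.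
Qed.

(** The limit S satisfies 2S = C + S^2, hence (I - S)^2 = I - C; and I - S is positive because S is
    a self-adjoint contraction. *)
Lemma sqrt_exists : exists A, positive_op ip A /\ A \o A = (fun x => x - C x).
Proof.
have /choice[S Scvg] := sqrt_iter_cvg.
have linS : linear S.
  move=> a x y; apply: (cvg_unique _ (Scvg (a *: x + y))); first exact: norm_hausdorff.
  have -> : (fun n => Y n (a *: x + y)) = (fun n => a *: Y n x + Y n y).
    by apply/funext => n; exact: sqrt_iter_linear.
  by apply: cvgD => //; apply: cvgZr.
have normS x : `|S x| <= `|x|.
  apply: (cvg_norm_le (N := 0) (Scvg x)) => n _.
  rewrite (le_trans (norm_sqrt_iter _ _))// ler_piMl//.
  by rewrite -[1]/(1%:C%C) lecR; case/andP: (sqrt_bound_itv n).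
have selfS : is_adjoint ip S S.
  by move=> x y; apply: (ip_cvg_eq (Scvg x) (Scvg y)) => n; exact: sqrt_iter_self.
have YY x : Y n (Y n x) @[n --> \oo] --> S (S x).
  apply/cvg_seqP => eps e0; have e2 : 0 < eps / 2 by rewrite divr_gt0.
  have /cvg_seqP/(_ _ e2)[N hN] := Scvg (S x); have /cvg_seqP/(_ _ e2)[M hM] := Scvg x.
  exists (maxn N M) => n; rewrite geq_max => /andP[/hN h1 /hM h2].
  (* Passing through Y_n (S x) separates the two limits; the second term is controlled because Y_n
     is a contraction. *)
  rewrite -(subrKA (Y n (S x))) (le_lt_trans (ler_normD _ _))//.
  rewrite [eps]splitr ltrD// -(linB (sqrt_iter_linear n)) (le_lt_trans _ h2)//.
  rewrite (le_trans (norm_sqrt_iter _ _))// ler_piMl//.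
  by rewrite -[1]/(1%:C%C) lecR; case/andP: (sqrt_bound_itv n).
have sqS x : S x + S x = C x + S (S x).
  have Sx : Y n.+1 x @[n --> \oo] --> S x by have := Scvg x; rewrite -cvg_shiftS.
  have E : (fun n => Y n.+1 x + Y n.+1 x) = (fun n => C x + Y n (Y n x)).
    by apply/funext => n /=; rewrite -scalerDl -[2^-1]mul1r -splitr scale1r.
  have CS : C x + Y n (Y n x) @[n --> \oo] --> C x + S (S x).
    by apply: cvgD => //; exact: cvg_cst.
  rewrite -E in CS; apply: (cvg_unique _ (cvgD Sx Sx) CS); exact: norm_hausdorff.
exists (fun x => x - S x); split; last first.
  apply/funext => x /=; have -> : C x = S x + S x - S (S x) by rewrite sqS addrK.
  by rewrite (linB linS) !opprB -addrA [- _ + _]addrCA opprD.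
split; first split.
- by move=> a x y; rewrite linS scalerBr opprD addrACA.
- exists 2; split=> // x; rewrite (le_trans (ler_normB _ _))// mulr_natl mulr2n.
  by rewrite lerD.
move=> x; rewrite ipBl subr_ge0 ip_norm.
(* Comparing <S x, x> with its modulus requires it to be real. *)
have rS : ip (S x) x \is Num.real by apply/CrealP; rewrite -ipC selfS.
rewrite (le_trans (real_ler_norm rS))// (le_trans (cauchy_schwarz _ _))//.
by rewrite expr2 ler_wpM2r.
Qed.

End SquareRoot.

(** * Defect spaces *)

(** Polarization: the quadratic form is real at [x + y] and at [x + 'i *: y], so p + q is real and p
    - q is purely imaginary, which gives p = q^*. *)
Lemma positive_self_adjoint A : positive_op ip A -> is_adjoint ip A A.
Proof.
move=> [[linA _] posA] x y.
have reA z : (ip (A z) z)^* = ip (A z) z by apply/CrealP/ger0_real/posA.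
have h1 := reA (x + y); have h2 := reA (x + 'i *: y).
rewrite (linD linA) !ipDl !ipDr !rmorphD /= !reA in h1.
rewrite (linD linA) (linZ linA) !ipDl !ipDr !ipZl !ipZr !rmorphD in h2.
rewrite !rmorphM /= conjCK conjCi !reA in h2.
rewrite (ipC x (A y)); move: h1 h2; set p := ip (A x) y; set q := ip (A y) x.
move=> h1 h2; move/eqP: h2; rewrite -subr_eq0; move/eqP; move/eqP: h1; rewrite -subr_eq0; move/eqP.
set L1 := (X in X = 0) => h1; set L2 := (X in X = 0) => h2.
have e2 : p^* - q^* + p - q = 0.
  by apply: (mulfI (@neq0Ci R[i])); rewrite mulr0 -[RHS]h2 /L2; ring.
apply: (mulfI (x := 2)); first by rewrite pnatr_eq0.
apply/subr0_eq; transitivity ((p^* - q^* + p - q) - L1); first by rewrite /L1; ring.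
by rewrite e2 h1 subr0.
Qed.

Lemma closure_subspace (M : set H) : M 0 ->
  (forall x y, M x -> M y -> M (x + y)) -> (forall a x, M x -> M (a *: x)) ->
  closed_subspace (closure M).
Proof.
move=> M0 MD MZ; split; last exact: closed_closure.
- exact: subset_closure.
- move=> x y /closure_norm cx /closure_norm cy; apply/closure_norm => eps e0.
  have e2 : 0 < eps / 2 by rewrite divr_gt0.
  have [x' Mx' hx] := cx _ e2; have [y' My' hy] := cy _ e2.
  exists (x' + y'); first exact: MD.
  by rewrite opprD addrACA [eps]splitr (le_lt_trans (ler_normD _ _))// ltrD.
- move=> a x /closure_norm cx; apply/closure_norm => eps e0.
  have a1 : 0 < `|a| + 1 by rewrite ltr_wpDl.
  have [y My xy] := cx (eps / (`|a| + 1)) (divr_gt0 e0 a1).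
  exists (a *: y); first exact: MZ.
  rewrite -scalerBr normrZ (le_lt_trans (ler_wpM2l _ (ltW xy)))//.
  by rewrite mulrCA gtr_pMr// ltr_pdivrMr// mul1r ltrDl.
Qed.

Lemma closure_orthogonal (M : set H) y :
  (forall x, M x -> ip x y = 0) -> forall x, closure M x -> ip x y = 0.
Proof.
move=> h x Mx; apply: (@closed_orthogonal [set y] x) => //.
by apply: closure_subset Mx => z Mz _ ->; exact: h.
Qed.

Section Defect.
Variable T : H -> H.
Hypotheses (bT : bounded_linear T) (cT : contraction_op T).
Local Notation Ts := (op_adjoint ip T).

(** The square root is selected by [epsilon]; the root built for the self-adjoint contraction T^*T
    shows that the selected operator meets its specification. *)
Lemma defect_root : exists B, [/\ positive_op ip B,
  B \o B = (fun x => x - Ts (T x)) & defect_space ip T = closure (range B)].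
Proof.
have [[linTs _] adj] := op_adjointP bT; have [linT _] := bT.
have /(ClassicalEpsilon.epsilon_spec (inhabits (fun x : H => x)))[posB BB] :
    exists B, positive_op ip B /\ B \o B = (fun x => x - Ts (T x)).
  apply: (@sqrt_exists (Ts \o T)).
  - by move=> a x y /=; rewrite linT linTs.
  - by move=> x; exact: le_trans (contraction_adjoint cT adj _) (cT x).
  - by move=> x y /=; rewrite (is_adjoint_sym adj) adj.
by exists (op_sqrt ip (fun x => x - Ts (T x))).
Qed.

(** As B is self-adjoint, the orthogonal complement of its range is ker B, and ker B = ker B^2 since
    |B y|^2 = <B^2 y, y>. *)
Lemma defect_perp y : (forall x, defect_space ip T x -> ip x y = 0) <-> Ts (T y) = y.
Proof.
have [B [posB BB ->]] := defect_root; have selfB := positive_self_adjoint posB.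
have [[linB' _] _] := posB.
split=> [h|Ty].
  have By : B y = 0.
    apply: ip_ext => z; rewrite ip0l; apply: ip_eq0C; rewrite -selfB.
    by apply/h/subset_closure; exists z.
  by have := congr1 (@^~ y) BB; rewrite /= By (lin0 linB') => /esym/subr0_eq/esym.
have BBy : B (B y) = 0 by have := congr1 (@^~ y) BB; rewrite /= Ty subrr.
have By : B y = 0 by apply: ip_eq0; rewrite -selfB BBy ip0l.
by apply: closure_orthogonal => _ [x _ <-]; rewrite selfB By ip0r.
Qed.

(** A closed subspace is its own double orthogonal complement. This describes the defect space
    without a square root. *)
Lemma defectP x : defect_space ip T x <-> (forall y, Ts (T y) = y -> ip x y = 0).
Proof.
split=> [Dx y /defect_perp|h]; first exact.
have cD : closed_subspace (defect_space ip T).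
  have [B [[[linB' _] _] _ ->]] := defect_root.
  apply: closure_subspace; first by exists 0 => //; exact: lin0.
  - by move=> _ _ [y _ <-] [z _ <-]; exists (y + z) => //; exact: linD.
  - by move=> a _ [y _ <-]; exists (a *: y) => //; exact: linZ.
have [p Dp pD] := projection x cD.
have Txp : Ts (T (x - p)) = x - p by apply/defect_perp => y /pD/ip_eq0C.
suff /ip_eq0/subr0_eq -> : ip (x - p) (x - p) = 0 by [].
by rewrite ipBl h// (ip_eq0C (pD _ Dp)) subr0.
Qed.

End Defect.

(** * Orthonormal families *)

Lemma left_kernel (m n : nat) (A : 'M[R[i]]_(m, n)) : (n < m)%N ->
  exists2 u : 'rV_m, u != 0 & u *m A = 0.
Proof.
move=> nm; have /rowV0Pn[u /sub_kermxP uA u0] : kermx A != 0.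
  rewrite kermx_eq0 /row_free neq_ltn.
  by rewrite (leq_ltn_trans (rank_leq_col A)).
by exists u.
Qed.

Lemma unit_vector_orthogonal (D : set H) (n m : nat) (g : nat -> H) :
  has_dim D n -> (m < n)%N ->
  exists x, [/\ D x, ip x x = 1 & forall i, (i < m)%N -> ip x (g i) = 0].
Proof.
move=> [v [indv ->]] mn.
(* Orthogonality to [m] vectors is [m] linear equations in [n] coordinates; [u] is a nonzero
   solution. *)
have [u u0 uA] := left_kernel (\matrix_(i < n, j < m) ip (v i) (g j)) mn.
pose x := \sum_(i < n) u 0 i *: v i.
have x0 : `|x| != 0.
  rewrite normr_eq0; apply: contraNneq u0 => /indv u0.
  by apply/eqP/rowP => i; rewrite u0 mxE.
exists (`|x|^-1 *: x); split.
- exists (fun i => `|x|^-1 * u 0 i); rewrite scaler_sumr.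
  by apply: eq_bigr => i _; rewrite scalerA.
- rewrite ipZl ipZr ip_norm fmorphV/= conj_Creal ?normr_real//.
  by rewrite mulrA -invfM -expr2 mulVf// expf_neq0.
move=> i im; have /matrixP/(_ 0 (Ordinal im)) := uA.
rewrite !mxE ipZl ip_suml => e; apply/eqP; rewrite mulf_eq0; apply/orP; right.
by apply/eqP; rewrite -[RHS]e; apply: eq_bigr => j _; rewrite mxE ipZl.
Qed.

(** The n + 1 vectors satisfy a nontrivial linear relation; pairing it with a [w i] whose
    coefficient is nonzero gives |w_i|^2 = 0. *)
Lemma orthogonal_family_dim (D : set H) (n : nat) (w : nat -> H) :
  has_dim D n -> (forall i, (i <= n)%N -> D (w i)) ->
  (forall i j, (i <= n)%N -> (j <= n)%N -> i != j -> ip (w i) (w j) = 0) ->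
  exists2 i, (i <= n)%N & w i = 0.
Proof.
move=> [v [indv ->]] Dw ow.
have /choice[c cw] (i : 'I_n.+1) :
  exists c : 'I_n -> R[i], w i = \sum_(j < n) c j *: v j by apply: Dw; rewrite -ltnS.
have [u u0 uA] := left_kernel (\matrix_(i, j) c i j) (ltnSn n).
have [i ui] : exists i, u 0 i != 0.
  apply/existsP; apply: contraNT u0; rewrite negb_exists => /forallP h.
  by apply/eqP/rowP => i; rewrite mxE; apply/eqP; rewrite -[_ == _]negbK.
have uw : \sum_(i < n.+1) u 0 i *: w i = 0.
  under eq_bigr do rewrite cw scaler_sumr.
  rewrite exchange_big big1// => j _.
  under eq_bigr do rewrite scalerA.
  rewrite -scaler_suml; have /matrixP/(_ 0 j) := uA; rewrite !mxE => uAj.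
  suff -> : \sum_i u 0 i * c i j = 0 by rewrite scale0r.
  by rewrite -[RHS]uAj; apply: eq_bigr => l _; rewrite mxE.
exists i; first by rewrite -ltnS.
have : ip (\sum_(l < n.+1) u 0 l *: w l) (w i) = 0 by rewrite uw ip0l.
have uwi (j : 'I_n.+1) : j != i -> ip (u 0 j *: w j) (w i) = 0.
  by move=> ji; rewrite ipZl (ow j i) ?mulr0// -ltnS.
rewrite ip_suml (bigD1 i)//= big1 ?addr0; last exact: uwi.
rewrite ipZl => /eqP.
by rewrite mulf_eq0 (negbTE ui) /= => /eqP; exact: ip_eq0.
Qed.

Lemma orthonormal_extension (D : set H) (n : nat) (e : H) :
  has_dim D n.+1 -> D e -> ip e e = 1 ->
  exists g : nat -> H, [/\ g 0%N = e, forall i, (i <= n)%N -> D (g i) &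
    forall i j, (i <= n)%N -> (j <= n)%N -> ip (g i) (g j) = (i == j)%:R].
Proof.
move=> dimD De e1; suff : forall m, (m <= n)%N ->
  exists g : nat -> H, [/\ g 0%N = e, forall i, (i <= m)%N -> D (g i) &
    forall i j, (i <= m)%N -> (j <= m)%N -> ip (g i) (g j) = (i == j)%:R].
  by move/(_ n (leqnn n)).
elim=> [_|m ih mn].
  by exists (fun=> e); split=> // i j; rewrite !leqn0 => /eqP-> /eqP->; rewrite e1.
have [g [g0 gD og]] := ih (ltnW mn).
have [x [Dx x1 xg]] := @unit_vector_orthogonal _ _ m.+1 g dimD mn.
exists (fun i => if i == m.+1 then x else g i); split=> //.
  by move=> i; case: ltngtP => // im _; exact: gD.
move=> i j; rewrite leq_eqVlt => /orP[/eqP->|im]; rewrite leq_eqVlt => /orP[/eqP->|jm].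
- by rewrite eqxx.
- by rewrite eqxx (ltn_eqF jm) (gtn_eqF jm) xg.
- by rewrite eqxx (ltn_eqF im) (ip_eq0C (xg _ im)).
- by rewrite (ltn_eqF im) (ltn_eqF jm); exact: og.
Qed.

(** Otherwise [x] and the [g i] would be n + 1 nonzero pairwise orthogonal vectors in dimension
    [n]. *)
Lemma orthonormal_complete (D : set H) (n : nat) (g : nat -> H) x :
  has_dim D n -> (forall i, (i < n)%N -> D (g i)) ->
  (forall i j, (i < n)%N -> (j < n)%N -> ip (g i) (g j) = (i == j)%:R) ->
  D x -> (forall i, (i < n)%N -> ip x (g i) = 0) -> x = 0.
Proof.
move=> dimD gD og Dx xg.
have [||i ni] := @orthogonal_family_dim D n (fun i => if i == n then x else g i) dimD.
- by move=> i; case: ltngtP => // im _; exact: gD.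
- move=> i j; rewrite leq_eqVlt => /orP[/eqP->|im]; rewrite leq_eqVlt => /orP[/eqP->|jm] ij.
  + by rewrite eqxx in ij.
  + by rewrite eqxx (ltn_eqF jm) xg.
  + by rewrite eqxx (ltn_eqF im) (ip_eq0C (xg _ im)).
  + by rewrite (ltn_eqF im) (ltn_eqF jm) og// (negbTE ij).
case: (ltngtP i n) ni => // im _ gi0.
by have /eqP := og i i im im; rewrite gi0 ip0l eqxx eq_sym oner_eq0.
Qed.

Section OrthonormalSequence.
Variables (n : nat) (g : nat -> H).
Hypothesis og : forall i j, (i < n)%N -> (j < n)%N -> ip (g i) (g j) = (i == j)%:R.

Lemma ip_orthonormal_sum (c : 'I_n -> R[i]) (j : 'I_n) :
  ip (\sum_(i < n) c i *: g i) (g j) = c j.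
Proof.
rewrite ip_suml (bigD1 j)//= big1 ?addr0.
  by rewrite ipZl og// eqxx mulr1.
by move=> i; rewrite -val_eqE => /negbTE ij; rewrite ipZl og//= ij mulr0.
Qed.

Lemma norm_orthonormal_sum (c : 'I_n -> R[i]) :
  `|\sum_(i < n) c i *: g i| ^+ 2 = \sum_(i < n) `|c i| ^+ 2.
Proof.
rewrite -ip_norm ip_sumr; apply: eq_bigr => j _.
by rewrite ipZr ip_orthonormal_sum mulrC -normCK.
Qed.

Lemma orthonormal_expansion (D : set H) x :
  has_dim D n -> (forall i, (i < n)%N -> D (g i)) -> D x ->
  x = \sum_(i < n) ip x (g i) *: g i.
Proof.
move=> dimD gD Dx; apply/subr0_eq.
apply: (orthonormal_complete dimD gD og).
  have [v [_ DE]] := dimD; move: Dx; rewrite DE => -[c ->].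
  have /choice[d dE] (i : 'I_n) : exists d : 'I_n -> R[i], g i = \sum_(j < n) d j *: v j.
    by have := gD i (ltn_ord i); rewrite DE.
  (* Coordinates, in the spanning family [v], of [x] minus its expansion along [g]. *)
  exists (fun j => c j - \sum_(i < n) ip (\sum_(l < n) c l *: v l) (g i) * d i j).
  under [RHS]eq_bigr do rewrite scalerBl scaler_suml.
  rewrite sumrB exchange_big; congr (_ - _); apply: eq_bigr => i _.
  by rewrite {2}dE scaler_sumr; apply: eq_bigr => j _; rewrite scalerA.
move=> i ni; rewrite ipBl.
by rewrite (ip_orthonormal_sum (fun i : 'I_n => ip x (g i)) (Ordinal ni)) subrr.
Qed.

End OrthonormalSequence.

(** Padding the coefficients with zeros lets two finite combinations share a length and be added. *)
Lemma span_seq_extend (e : nat -> H) x : span_seq e x -> exists n, forall m, (n <= m)%N ->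
  exists c : nat -> R[i], x = \sum_(i < m) c i *: e i.
Proof.
move=> [n [c ->]]; exists n => m nm.
pose d i := if insub i is Some j then c j else 0.
exists d; transitivity (\sum_(i < n) d i *: e i).
  by apply: eq_bigr => i _; rewrite /d valK.
rewrite (big_ord_widen m (fun i => d i *: e i) nm) big_mkcond.
by apply: eq_bigr => i _; case: ifPn => // ni; rewrite /d insubN// scale0r.
Qed.

Lemma closure_span_seq (e : nat -> H) : closed_subspace (closure (span_seq e)).
Proof.
apply: closure_subspace.
- by exists 0%N, (fun=> 0); rewrite big_ord0.
- move=> x y /span_seq_extend[n hx] /span_seq_extend[m hy].
  have [c ->] := hx (n + m)%N (leq_addr _ _); have [d ->] := hy (n + m)%N (leq_addl _ _).
  exists (n + m)%N, (fun i => c i + d i); rewrite -big_split/=.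
  by apply: eq_bigr => i _; rewrite scalerDl.
- move=> a _ [n [c ->]]; exists n, (fun i => a * c i); rewrite scaler_sumr.
  by apply: eq_bigr => i _; rewrite scalerA.
Qed.

Lemma mem_span_seq (e : nat -> H) n : span_seq e (e n).
Proof.
exists n.+1, (fun i => (i == ord_max)%:R); rewrite (bigD1 ord_max)//= eqxx scale1r.
by rewrite big1 ?addr0// => i /negbTE->; rewrite scale0r.
Qed.

Lemma total_orthonormal_basis (e : nat -> H) :
  (forall m n, ip (e m) (e n) = (m == n)%:R) ->
  (forall x, (forall n, ip x (e n) = 0) -> x = 0) -> orthonormal_basis ip e.
Proof.
move=> oe tot; split=> //; apply/seteqP; split=> // x _.
have [p sp pe] := projection x (closure_span_seq e).
rewrite (_ : x = p)//; apply/subr0_eq/tot => n; apply: pe.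
exact/subset_closure/mem_span_seq.
Qed.

Lemma orthonormal_basis_total (e : nat -> H) x : orthonormal_basis ip e ->
  (forall n, ip x (e n) = 0) -> x = 0.
Proof.
move=> [_ eT] xe; apply: ip_eq0; apply: (@closure_orthogonal (span_seq e)); last by rewrite eT.
move=> _ [n [c ->]]; rewrite ip_suml big1// => i _.
by rewrite ipZl ip_eq0C ?mulr0.
Qed.

(* [|x|^2 - |T x|^2 = <(I - T^*T) x, x> = |B x|^2], where B is the defect operator. *)
Lemma isometric_fixed T x : bounded_linear T -> contraction_op T ->
  `|T x| = `|x| -> op_adjoint ip T (T x) = x.
Proof.
move=> bT cT Tx; have [_ adj] := op_adjointP bT.
have [B [posB BB _]] := defect_root bT cT; have selfB := positive_self_adjoint posB.
have BBx := congr1 (@^~ x) BB; rewrite /= in BBx.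
have Bx : B x = 0.
  apply: ip_eq0; rewrite -selfB BBx ipBl (is_adjoint_sym adj) !ip_norm Tx.
  exact: subrr.
by have [[linB' _] _] := posB; move: BBx; rewrite Bx (lin0 linB') => /esym/subr0_eq.
Qed.

(** * From the defect spaces to the shift *)

Section Forward.
Variables (T : H -> H) (k : nat).
Hypotheses (bT : bounded_linear T) (k0 : (0 < k)%N).
Hypotheses (cT : contraction_op T) (cnuT : completely_non_unitary ip T).
Local Notation Ts := (op_adjoint ip T).
Hypotheses (subD : defect_space ip T `<=` defect_space ip Ts).
Hypotheses (dimD : has_dim (defect_space ip T) 1).
Hypotheses (dimD' : has_dim (defect_space ip Ts) k.+1).

Let bTs : bounded_linear Ts. Proof. by have [] := op_adjointP bT. Qed.
Let adj : is_adjoint ip T Ts. Proof. by have [] := op_adjointP bT. Qed.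
Let adjs : is_adjoint ip Ts T. Proof. exact: is_adjoint_sym. Qed.
Let cTs : contraction_op Ts. Proof. exact: contraction_adjoint cT adj. Qed.

Lemma ip_fixed x z : Ts (T z) = z -> ip (T x) (T z) = ip x z.
Proof. by move=> Tz; rewrite adj Tz. Qed.

Lemma defect_adjoint_perp y :
  (forall x, defect_space ip Ts x -> ip x y = 0) <-> T (Ts y) = y.
Proof. by rewrite (defect_perp bTs cTs) op_adjointK. Qed.

(** If T^*T z = z, then T z is fixed by TT^*, hence orthogonal to the defect space of T^*. *)
Lemma image_fixed_perp x z : defect_space ip Ts x -> Ts (T z) = z -> ip x (T z) = 0.
Proof. by move=> Dx Tz; move: x Dx; apply/defect_adjoint_perp; rewrite Tz. Qed.

(** If TT^* fixes y, then T^*T fixes T^* y, so <T x, y> = <x, T^* y> = 0. *)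
Lemma image_defect x : defect_space ip T x -> defect_space ip Ts (T x).
Proof.
move=> Dx; apply/(defectP bTs cTs) => y; rewrite op_adjointK// => TTy.
by rewrite adj; apply: ((defectP bT cT x).1 Dx); rewrite TTy.
Qed.

Section Basis.
Variable g : nat -> H.
Hypothesis g0D : defect_space ip T (g 0%N).
Hypothesis gD : forall i, (i <= k)%N -> defect_space ip Ts (g i).
Hypothesis og : forall i j, (i <= k)%N -> (j <= k)%N -> ip (g i) (g j) = (i == j)%:R.

(* With n - 1 = q k + r, the vector e_n is T^q g_(r+1); hence e_(n+k) = T e_n for n >= 1. *)
Definition shift_basis n :=
  if n is m.+1 then iter (m %/ k) T (g (m %% k).+1) else g 0.
Local Notation e := shift_basis.

Lemma shift_basis_le n : (n <= k)%N -> e n = g n.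
Proof. by case: n => //= n nk; rewrite divn_small// modn_small. Qed.

Lemma shift_basisS n : (0 < n)%N -> e (n + k) = T (e n).
Proof. by case: n => //= n _; rewrite divnDr// divnn k0 addn1 modnDr. Qed.

Lemma fixed_perp_e0 z : Ts (T z) = z <-> ip z (g 0%N) = 0.
Proof.
rewrite -(defect_perp bT cT); split=> [h|h x Dx].
  by apply: ip_eq0C; apply: h.
rewrite (@orthonormal_expansion 1 (fun=> g 0%N) _ _ x dimD)//.
  by rewrite big_ord1 ipZl (ip_eq0C h) mulr0.
by case=> // -[]// _ _; rewrite og.
Qed.

(** Past [k], e_n = T e_m where e_m is fixed by induction, so e_n is orthogonal to the defect space
    of T^*, which contains [g 0]. *)
Lemma ip_shift_basis0 n : (0 < n)%N -> ip (e n) (g 0%N) = 0.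
Proof.
elim/ltn_ind: n => n ih n0.
have [nk|/(ltn_split k0)[m /andP[m0 mn] nE]] := leqP n k.
  by rewrite shift_basis_le// og// gtn_eqF.
apply: ip_eq0C; rewrite nE shift_basisS//; apply: image_fixed_perp; first exact: gD.
by apply/fixed_perp_e0/ih.
Qed.

Lemma fixed_shift_basis n : (0 < n)%N -> Ts (T (e n)) = e n.
Proof. by move=> /ip_shift_basis0/fixed_perp_e0. Qed.

Lemma ip_shift_basis m n : ip (e m) (e n) = (m == n)%:R.
Proof.
have lo i j : (i <= k)%N -> (k < j)%N -> ip (e i) (e j) = 0.
  move=> ik /(ltn_split k0)[j' /andP[j0 _] ->].
  rewrite shift_basisS// shift_basis_le//.
  by apply: image_fixed_perp; [exact: gD|exact: fixed_shift_basis].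
elim/ltn_ind: m n => m ih n.
have [mk|mk] := leqP m k; have [nk|nk] := leqP n k.
- by rewrite !shift_basis_le// og.
- by rewrite lo// ltn_eqF// (leq_ltn_trans mk).
- by rewrite (ip_eq0C (lo _ _ nk mk)) gtn_eqF// (leq_ltn_trans nk).
(* When both indices exceed [k], both vectors are images of fixed vectors, where T preserves inner
   products; both indices drop by [k]. *)
have [m' /andP[m0 mm] mE] := ltn_split k0 mk.
have [n' /andP[n0 _] nE] := ltn_split k0 nk.
rewrite mE nE !shift_basisS// ip_fixed; last exact: fixed_shift_basis.
by rewrite ih// eqn_add2r.
Qed.

Lemma perp_defect_adjoint x : (forall i, (i <= k)%N -> ip x (g i) = 0) -> T (Ts x) = x.
Proof.
move=> xg; apply/defect_adjoint_perp => y Dy; apply: ip_eq0C.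
rewrite (@orthonormal_expansion k.+1 g og _ y dimD' gD Dy) ip_sumr big1// => i _.
by rewrite ipZr xg ?mulr0// -ltnS.
Qed.

Lemma shift_basis_total x : (forall n, ip x (e n) = 0) -> x = 0.
Proof.
pose M := [set x | forall y, range e y -> ip x y = 0].
have ME z : M z <-> (forall n, ip z (e n) = 0).
  by split=> [h n|h _ [n _ <-]]; [apply: h; exists n|exact: h].
have Mg z i : M z -> (i <= k)%N -> ip z (g i) = 0.
  by move=> /ME h /shift_basis_le <-.
have Tg0 : T (g 0%N) = \sum_(i < k.+1) ip (T (g 0%N)) (g i) *: g i.
  exact: (@orthonormal_expansion k.+1 g og _ _ dimD' gD (image_defect g0D)).
have fixM z : M z -> Ts (T z) = z by move=> Mz; apply/fixed_perp_e0/Mg.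
(* Against e_0 one gets <z, T e_0>, zero because T e_0 is a combination of e_0, ..., e_k; against
   e_(n+1) one gets <z, e_(n+1+k)>. *)
have Ts_M z : M z -> M (Ts z).
  move=> Mz; apply/ME => -[|n].
    rewrite adjs Tg0 ip_sumr big1// => i _.
    have ik : (i <= k)%N by rewrite -ltnS.
    by rewrite ipZr (Mg z i Mz ik) mulr0.
  by rewrite adjs -shift_basisS//; apply: (ME z).1.
(* Up to index [k], T z is orthogonal to the defect space of T^*; beyond it, <T z, T e_m> = <z,
   e_m>. *)
have T_M z : M z -> M (T z).
  move=> Mz; apply/ME => n.
  have [nk|/(ltn_split k0)[m /andP[m0 _] ->]] := leqP n k.
    rewrite shift_basis_le//; apply: ip_eq0C.
    by apply: image_fixed_perp; [exact: gD|exact: fixM].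
  rewrite shift_basisS// ip_fixed; last exact: fixed_shift_basis.
  exact: (ME z).1.
suff ME0 : M = [set 0] by move=> /ME; rewrite ME0.
apply: cnuT.
  split; [|by move=> _ [z /T_M Mz <-]|by move=> _ [z /Ts_M Mz <-]].
  split; [|move=> y z My Mz w ew|move=> a y My w ew|exact: closed_orthogonal].
  - by move=> y _; exact: ip0l.
  - by rewrite ipDl My// Mz// addr0.
  - by rewrite ipZl My// mulr0.
split=> z Mz.
  by apply/eqP; rewrite -(@eqrXn2 _ 2)// -!ip_norm ip_fixed// fixM.
by exists (Ts z); [exact: Ts_M|apply: perp_defect_adjoint => i; exact: Mg].
Qed.

End Basis.

Lemma shift_model_of_defects : exists (e : nat -> H) (alpha : 'I_k.+1 -> R[i]),
  [/\ orthonormal_basis ip e, \sum_(i < k.+1) `|alpha i| ^+ 2 < 1,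
    forall n, (0 < n)%N -> T (e n) = e (n + k)%N &
    T (e 0%N) = \sum_(i < k.+1) alpha i *: e i].
Proof.
have [e0 [De0 e01 _]] := @unit_vector_orthogonal _ _ 0 (fun=> 0) dimD (ltnSn 0).
have [g [g0 gD og]] := orthonormal_extension dimD' (subD De0) e01.
have g0D : defect_space ip T (g 0%N) by rewrite g0.
have eE (i : 'I_k.+1) : shift_basis g i = g i by rewrite shift_basis_le// -ltnS.
have Tg0 : T (g 0%N) = \sum_(i < k.+1) ip (T (g 0%N)) (g i) *: g i.
  exact: (@orthonormal_expansion k.+1 g og _ _ dimD' gD (image_defect g0D)).
exists (shift_basis g), (fun i => ip (T (g 0%N)) (g i)); split.
- apply: total_orthonormal_basis.
    exact: ip_shift_basis.
  exact: shift_basis_total.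
- rewrite -(@norm_orthonormal_sum k.+1 g og) -Tg0 -e01 -g0 ip_norm.
  (* Equality |T e_0| = |e_0| would make e_0 fixed by T^*T, hence orthogonal to the defect space it
     lies in, that is, to itself. *)
  rewrite ltr_pXn2r ?nnegrE// lt_neqAle cT andbT; apply/eqP => /(isometric_fixed bT cT).
  move=> /((defectP bT cT _).1 g0D)/eqP.
  by rewrite g0 e01 oner_eq0.
- by move=> n n0; rewrite shift_basisS.
- by rewrite [LHS]Tg0; apply: eq_bigr => i _; rewrite eE.
Qed.

End Forward.

(** * From the shift to the defect spaces *)

Section Backward.
Variables (T : H -> H) (k : nat) (e : nat -> H) (alpha : 'I_k.+1 -> R[i]).
Hypotheses (bT : bounded_linear T) (k0 : (0 < k)%N).
Hypotheses (be : orthonormal_basis ip e) (alpha1 : \sum_(i < k.+1) `|alpha i| ^+ 2 < 1).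
Hypotheses (Te : forall n, (0 < n)%N -> T (e n) = e (n + k)%N).
Hypothesis Te0 : T (e 0%N) = \sum_(i < k.+1) alpha i *: e i.
Local Notation Ts := (op_adjoint ip T).
Local Notation w := (T (e 0%N)).
Local Notation delta := (1 - `|w| ^+ 2).

Let bTs : bounded_linear Ts. Proof. by have [] := op_adjointP bT. Qed.
Let adj : is_adjoint ip T Ts. Proof. by have [] := op_adjointP bT. Qed.
Let adjs : is_adjoint ip Ts T. Proof. exact: is_adjoint_sym. Qed.
Let oe m n : ip (e m) (e n) = (m == n)%:R. Proof. by case: be. Qed.
Let tot x : (forall n, ip x (e n) = 0) -> x = 0.
Proof. exact: orthonormal_basis_total. Qed.

Lemma delta_gt0 : 0 < delta.
Proof. by rewrite subr_gt0 Te0 (@norm_orthonormal_sum k.+1 e). Qed.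

Lemma ip_Te0_gt n : (k < n)%N -> ip w (e n) = 0.
Proof.
move=> kn; rewrite Te0 ip_suml big1// => i _.
by rewrite ipZl oe ltn_eqF ?mulr0// (leq_ltn_trans _ kn)// -ltnS.
Qed.

(** Computed on basis vectors first; a general [x] follows by moving the self-adjoint operator I -
    T^*T onto e_m inside <., e_m>. *)
Lemma defect_operator x : x - Ts (T x) = (delta * ip x (e 0%N)) *: e 0%N.
Proof.
have Ae n : e n - Ts (T (e n)) = (delta * ip (e n) (e 0%N)) *: e 0%N.
  apply/subr0_eq/tot => m; rewrite !ipBl adjs ipZl !oe.
  case: n m => [|n] [|m]; rewrite /= ?mulr0 ?mul0r ?subr0 ?mulr1.
  - by rewrite ip_norm subrr.
  - by rewrite (Te (ltn0Sn m)) ip_Te0_gt ?subrr// addSn ltnS leq_addl.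
  - by rewrite (Te (ltn0Sn n)) (ip_eq0C (ip_Te0_gt _)) ?subrr// addSn ltnS leq_addl.
  - by rewrite !Te// oe eqn_add2r eqSS subrr.
apply/subr0_eq/tot => m; rewrite !ipBl adjs ipZl.
have := congr1 (ip x) (Ae m); rewrite ipBr -adj ipZr => ->.
rewrite !oe; case: m => [|m] /=.
  by rewrite !mulr1 conj_Creal ?gtr0_real ?delta_gt0// subrr.
by rewrite !mulr0 rmorph0 mul0r subrr.
Qed.

Lemma fixedE x : Ts (T x) = x <-> ip x (e 0%N) = 0.
Proof.
have d0 : delta != 0 by rewrite gt_eqF ?delta_gt0.
split=> [Tx|x0].
  have := congr1 (ip ^~ (e 0%N)) (defect_operator x).
  rewrite /= Tx subrr ip0l ipZl oe mulr1 => /esym/eqP.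
  by rewrite mulf_eq0 (negbTE d0) => /eqP.
by have := defect_operator x; rewrite x0 mulr0 scale0r => /subr0_eq/esym.
Qed.

(** The formula for I - T^*T gives |x|^2 - |T x|^2 = delta |<x, e_0>|^2. *)
Lemma contraction_T : contraction_op T.
Proof.
move=> x; rewrite -(@ler_pXn2r _ 2%N) ?nnegrE// -!ip_norm -subr_ge0 [X in _ - X]adj.
rewrite -ipBr defect_operator ipZr rmorphM /= (conj_Creal (gtr0_real delta_gt0)) -mulrA.
apply: mulr_ge0; first exact/ltW/delta_gt0.
by rewrite mulrC -normCK exprn_ge0.
Qed.

Lemma defect_space_model x :
  defect_space ip T x <-> exists a, x = a *: e 0%N.
Proof.
rewrite (defectP bT contraction_T); split=> [h|[a ->] y /fixedE y0].
  exists (ip x (e 0%N)); apply/subr0_eq/tot => n; rewrite ipBl ipZl oe.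
  case: n => [|n]; first by rewrite mulr1 subrr.
  by rewrite mulr0 subr0; apply/h/fixedE; rewrite oe.
by rewrite ipZl (ip_eq0C y0) mulr0.
Qed.

(** For m >= 1, <T^* e_i, e_m> = <e_i, e_(m+k)> vanishes because i <= k < m + k. *)
Lemma adjoint_basis_le i : (i <= k)%N -> Ts (e i) = ip (e i) w *: e 0%N.
Proof.
move=> ik; apply/subr0_eq/tot => -[|m]; rewrite ipBl adjs ipZl oe ?mulr1 ?subrr//.
rewrite mulr0 subr0 Te// oe ltn_eqF// addSn ltnS.
by rewrite (leq_trans ik)// leq_addl.
Qed.

(** If y is fixed, T^* y is fixed by T^*T, so orthogonal to e_0, while T^* e_i is a multiple of e_0.
    Conversely, TT^* y and y agree against each e_n, using T^* e_(m+k) = e_m for m >= 1. *)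
Lemma adjoint_fixedE y : T (Ts y) = y <-> forall i, (i <= k)%N -> ip y (e i) = 0.
Proof.
split=> [Ty|h].
  have /fixedE y0 : Ts (T (Ts y)) = Ts y by rewrite Ty.
  by move=> i ik; rewrite -Ty adj adjoint_basis_le// ipZr y0 mulr0.
have yw : ip y w = 0.
  rewrite Te0 ip_sumr big1// => i _.
  by rewrite ipZr h ?mulr0// -ltnS.
apply/subr0_eq/tot => n; rewrite ipBl adj.
have [nk|/(ltn_split k0)[m /andP[m0 _] ->]] := leqP n k.
  by rewrite adjoint_basis_le// ipZr adjs yw mulr0 h// subrr.
rewrite -Te// (fixedE _).2; last by rewrite oe gtn_eqF.
by rewrite adjs subrr.
Qed.

Lemma defect_space_adjoint_model x :
  defect_space ip Ts x <-> exists c : 'I_k.+1 -> R[i], x = \sum_(i < k.+1) c i *: e i.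
Proof.
have cTs := contraction_adjoint contraction_T adj.
rewrite (defectP bTs cTs) op_adjointK//; split=> [h|[c ->] y /adjoint_fixedE y0].
  exists (fun i => ip x (e i)); apply/subr0_eq/tot => n; rewrite ipBl.
  have [nk|nk] := leqP n k.
    have nk' : (n < k.+1)%N by rewrite ltnS.
    rewrite (@ip_orthonormal_sum k.+1 e _ (fun i => ip x (e i)) (Ordinal nk')) ?subrr//.
  rewrite h ?sub0r; last first.
    by apply/adjoint_fixedE => i ik; rewrite oe gtn_eqF// (leq_ltn_trans ik).
  rewrite ip_suml big1 ?oppr0// => i _.
  by rewrite ipZl oe ltn_eqF ?mulr0// (leq_ltn_trans _ nk)// -ltnS.
rewrite ip_suml big1// => i _.
by rewrite ipZl ip_eq0C ?mulr0// y0// -ltnS.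
Qed.

Lemma lin_indep_orthonormal n : lin_indep (fun i : 'I_n => e i).
Proof.
move=> c c0 i; have := @ip_orthonormal_sum n e _ c i.
by rewrite c0 ip0l => ->.
Qed.

Lemma completely_non_unitary_model : completely_non_unitary ip T.
Proof.
move=> M [[M0 _ _ _] TM TsM] [isoM ontoM].
have M_fixed x : M x -> Ts (T x) = x.
  by move=> /isoM; apply: isometric_fixed => //; exact: contraction_T.
(* Surjectivity of T on M turns T^*T = I on M into TT^* = I on M. *)
have M_adjoint_fixed x : M x -> T (Ts x) = x.
  by move=> Mx; have [z Mz zx] := ontoM _ Mx; rewrite -zx M_fixed.
have M_perp n x : M x -> ip x (e n) = 0.
  elim/ltn_ind: n x => n ih x Mx.
  have [nk|/(ltn_split k0)[m /andP[m0 mn] nE]] := leqP n k.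
    exact: (adjoint_fixedE x).1 (M_adjoint_fixed x Mx) n nk.
  rewrite nE -Te// -adjs; apply: ih => //.
  by apply: TsM; exists x.
apply/seteqP; split=> [x Mx|x ->//]; apply: tot => n; exact: M_perp.
Qed.

Lemma defects_of_shift_model :
  [/\ contraction_op T, completely_non_unitary ip T,
       defect_space ip T `<=` defect_space ip Ts,
       has_dim (defect_space ip T) 1 & has_dim (defect_space ip Ts) k.+1].
Proof.
split.
- exact: contraction_T.
- exact: completely_non_unitary_model.
- move=> _ /defect_space_model[a ->]; apply/defect_space_adjoint_model.
  exists (fun i => if i == ord0 then a else 0); rewrite (bigD1 ord0)//= big1 ?addr0//.
  by move=> i /negbTE ->; rewrite scale0r.
- exists (fun i : 'I_1 => e i); split; first exact: lin_indep_orthonormal.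
  apply/seteqP; split=> x.
    by move=> /defect_space_model[a ->]; exists (fun=> a); rewrite big_ord1.
  by move=> [c ->]; apply/defect_space_model; exists (c ord0); rewrite big_ord1.
- exists (fun i : 'I_k.+1 => e i); split; first exact: lin_indep_orthonormal.
  by apply/seteqP; split=> x /defect_space_adjoint_model.
Qed.

End Backward.

End HilbertSpace.

Unset Implicit Arguments.

Theorem theorem3p6 (R : realType) (H : completeNormedModType R[i])
    (ip : H -> H -> R[i]) (T : H -> H) (k : nat) :
  is_inner_product ip -> separable_space H -> infinite_dimensional H ->
  bounded_linear T -> (1 <= k)%N ->
  ([/\ contraction_op T, completely_non_unitary ip T,
       defect_space ip T `<=` defect_space ip (op_adjoint ip T),
       has_dim (defect_space ip T) 1 &
       has_dim (defect_space ip (op_adjoint ip T)) k.+1]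
   <->
   exists (e : nat -> H) (alpha : 'I_k.+1 -> R[i]),
     [/\ orthonormal_basis ip e,
         \sum_(i < k.+1) `|alpha i| ^+ 2 < 1 &
         forall n : nat,
           T (e n) = e (n + k)%N +
             (if n == 0%N then
                \sum_(i < k) alpha (widen_ord (leqnSn k) i) *: e i
                + (alpha ord_max - 1) *: e k
              else 0)]).
Proof.
move=> hip _ _ bT k0.
(* The -1 in the last coefficient of F cancels the e_k contributed by the shift, leaving T e_0 with
   coordinates [alpha]. *)
have model0 (e : nat -> H) (alpha : 'I_k.+1 -> R[i]) :
  e k + (\sum_(i < k) alpha (widen_ord (leqnSn k) i) *: e i + (alpha ord_max - 1) *: e k)
  = \sum_(i < k.+1) alpha i *: e i.
  by rewrite big_ord_recr/= addrCA scalerBl scale1r [e k + _]addrC subrK.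
split=> [[cT cnuT subD dimD dimD']|[e [alpha [be alpha1 Te]]]].
  have [e [alpha [be alpha1 Te Te0]]] :=
    shift_model_of_defects hip bT k0 cT cnuT subD dimD dimD'.
  exists e, alpha; split=> // -[|n]; first by rewrite Te0 add0n model0.
  by rewrite Te// addr0.
apply: (@defects_of_shift_model R H ip hip T k e alpha) => //.
  by case=> // n _; rewrite Te addr0.
by rewrite Te add0n model0.
Qed.
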